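(* Let $d\ge 1$, and let $C_0$, $C_k$ ($k\in\{1,\dots,d\}$) and $C_{\alpha}$ ($\alpha\in\mathbb{N}_0^d$, $|\alpha|=2$) be arbitrary real constants. For $f\in L_2(\mathbb{R}^d)$ define the base Riesz layer $$J_{\mathcal{R}}(f) = C_0+\sum_{k=1}^{d} C_k\,\mathcal{R}_k(f)+\sum_{\alpha\in\mathbb{N}_0^d,\ |\alpha|=2} C_{\alpha}\,\mathcal{R}^{\alpha}(f).$$ Then $J_{\mathcal{R}}$ is scale equivariant: for every $f\in L_2(\mathbb{R}^d)$ and every $a>0$, $$J_{\mathcal{R}}\Big(f\big(\tfrac{\cdot}{a}\big)\Big)=J_{\mathcal{R}}(f)\big(\tfrac{\cdot}{a}\big),$$ as an equality of functions on $\mathbb{R}^d$ (almost everywhere).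
   Context: $L_2(\mathbb{R}^d)$ is the set of square integrable functions $f:\mathbb{R}^d\to\mathbb{R}$ (modulo equality almost everywhere), and $\mathbb{N}_0=\{0,1,2,\dots\}$. For a function $g$ on $\mathbb{R}^d$ and $a>0$, $g(\frac{\cdot}{a})$ denotes the function $x\mapsto g(x/a)$. For $j\in\{1,\dots,d\}$ the first order Riesz transform $\mathcal{R}_j:L_2(\mathbb{R}^d)\to L_2(\mathbb{R}^d)$ is defined by $$\mathcal{R}_j(f)(x)=C_d\lim_{\varepsilon\to0}\int_{\mathbb{R}^d\setminus B_\varepsilon}\frac{y_j f(x-y)}{|y|^{d+1}}\,dy,\qquad C_d=\frac{\Gamma((d+1)/2)}{\pi^{(d+1)/2}},$$ where $B_\varepsilon$ is the ball of radius $\varepsilon$ centered at the origin (here $C_d$ is this normalizing constant, unrelated to the layer coefficients $C_k$); equivalently, with $\mathcal{F}$ the Fourier transform, $\mathcal{F}(\mathcal{R}_j(f))(u)=-i\frac{u_j}{|u|}\mathcal{F}(f)(u)$ for $u\ne0$. Higher order Riesz transforms are compositions: for $\alpha=(k_1,\dots,k_d)\in\mathbb{N}_0^d$, $\mathcal{R}^{\alpha}(f)=\mathcal{R}_1^{k_1}(\mathcal{R}_2^{k_2}(\cdots(\mathcal{R}_d^{k_d}(f))))$, where $\mathcal{R}_j^{k_j}$ means applying $\mathcal{R}_j$ $k_j$ times; $|\alpha|=k_1+\dots+k_d$. The term $C_0$ denotes the constant function, so $J_{\mathcal{R}}(f)$ is a function on $\mathbb{R}^d$ defined almost everywhere. 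*)

(* Defs.v *)
From HB Require Import structures.
From mathcomp Require Import all_boot all_order all_algebra.
From mathcomp Require Import all_classical all_reals all_analysis.

Set Implicit Arguments.
Unset Strict Implicit.
Unset Printing Implicit Defensive.

Import Order.TTheory GRing.Theory Num.Theory.
Import numFieldNormedType.Exports.

Local Open Scope classical_set_scope.
Local Open Scope ring_scope.

(* Points of R^d are d-tuples: d.-tuple R carries the product sigma-algebra,
   i.e., the Borel sets of R^d. *)
Section euclidean.
Context {R : realType} {d : nat}.
Implicit Types x y : d.-tuple R.

Definition tsub x y : d.-tuple R := [tuple tnth x i - tnth y i | i < d].

Definition tscale (c : R) x : d.-tuple R := [tuple c * tnth x i | i < d].

Definition enorm x : R := Num.sqrt (\sum_(i < d) tnth x i ^+ 2).

(* the function g(./a) *)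
Definition dilate (a : R) (g : d.-tuple R -> R) : d.-tuple R -> R :=
  fun x => g (tscale a^-1 x).

End euclidean.

(* Lebesgue measure on R^n, by recursion on n: Dirac mass on the one-point
   space R^0, and on R^(n+1) the image of the product of the one-dimensional
   Lebesgue measure and of the Lebesgue measure on R^n under (x, t) |-> x :: t.
   The recursion has to carry sigma-finiteness, which \x requires. *)
Section lebesgue_tuple.
Context {R : realType}.

Definition tcons n (p : measurableTypeR R * n.-tuple R) : n.+1.-tuple R :=
  [tuple of p.1 :: p.2].

Lemma measurable_tcons n : measurable_fun setT (@tcons n).
Proof.
apply: (@measurable_cons _ _ _ R (fun p => p.1) n (fun p => p.2)).
- exact: measurable_fst.
- exact: measurable_snd.
Qed.

Section step.
Variables (n : nat) (m : {sigma_finite_measure set (n.-tuple R) -> \bar R}).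

Definition leb_step : set (n.+1.-tuple R) -> \bar R :=
  pushforward (@lebesgue_measure R \x m)%E (@tcons n).

Let leb_step0 : leb_step set0 = 0%E.
Proof. by rewrite /leb_step /pushforward preimage_set0 measure0. Qed.

Let leb_step_ge0 A : (0 <= leb_step A)%E.
Proof. by rewrite /leb_step /pushforward; exact: measure_ge0. Qed.

Let mtcons A : measurable A -> measurable (@tcons n @^-1` A).
Proof.
by move=> mA; rewrite -[X in measurable X]setTI; exact: measurable_tcons.
Qed.

Let leb_step_sigma_additive : semi_sigma_additive leb_step.
Proof.
move=> F mF tF mUF; rewrite /leb_step /pushforward preimage_bigcup.
apply: measure_semi_sigma_additive.
- by move=> k; exact: mtcons.
- apply/trivIsetP => /= i j _ _ ij; rewrite -preimage_setI.
  by move/trivIsetP : tF => /(_ _ _ _ _ ij) ->//; rewrite preimage_set0.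
- by rewrite -preimage_bigcup; exact: mtcons.
Qed.

HB.instance Definition _ := isMeasure.Build _ _ _ leb_step
  leb_step0 leb_step_ge0 leb_step_sigma_additive.

Let leb_step_sigma_finite : sigma_finite setT leb_step.
Proof.
have /sigma_finiteP[F [FT ndF Foo]] := sigma_finiteT (@lebesgue_measure R).
have /sigma_finiteP[G [GT ndG Goo]] := sigma_finiteT m.
pose unc (t : n.+1.-tuple R) : measurableTypeR R * n.-tuple R :=
  (thead t, [tuple of behead t]).
have tconsK : cancel (@tcons n) unc.
  by move=> [x t]; rewrite /unc /tcons/= theadE; congr pair; apply: val_inj.
have munc : measurable_fun setT unc.
  apply/measurable_fun_pairP; split.
    exact: (@measurable_tnth _ _ n.+1 ord0).
  exact: measurable_behead.
exists (fun k => unc @^-1` (F k `*` G k)).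
  rewrite -preimage_bigcup; apply/esym; rewrite -subTset => t _ /=.
  have [i _ Fi] : (\bigcup_k F k) (unc t).1 by rewrite -FT.
  have [j _ Gj] : (\bigcup_k G k) (unc t).2 by rewrite -GT.
  exists (maxn i j) => //; split => /=.
  - by move: Fi; exact/subsetPset/ndF/leq_maxl.
  - by move: Gj; exact/subsetPset/ndG/leq_maxr.
move=> k; have [mFk Fkoo] := Foo k; have [mGk Gkoo] := Goo k; split.
  by rewrite -[X in measurable X]setTI; apply: munc => //; exact: measurableX.
rewrite /leb_step /pushforward -comp_preimage (_ : unc \o _ = id); last first.
  by apply/funext => p; exact: tconsK.
by rewrite preimage_id product_measure1E// lte_mul_pinfty// ge0_fin_numE.
Qed.

HB.instance Definition _ :=
  Measure_isSigmaFinite.Build _ _ _ leb_step leb_step_sigma_finite.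

End step.

Fixpoint leb n : {sigma_finite_measure set (n.-tuple R) -> \bar R} :=
  match n with
  | 0 => \d_([tuple] : 0.-tuple R)
  | n'.+1 => leb_step (leb n')
  end.

End lebesgue_tuple.

Section riesz.
Context {R : realType}.

(* Euler's Gamma function, for positive arguments *)
Definition Gamma (s : R) : R :=
  \int[lebesgue_measure]_(t in `]0, +oo[) (t `^ (s - 1) * expR (- t)).

Variable d : nat.
Implicit Types f : d.-tuple R -> R.

Definition riesz_cst : R :=
  Gamma (d.+1%:R / 2) / (pi `^ (d.+1%:R / 2)).

Definition riesz_trunc (j : 'I_d) f (x : d.-tuple R) (eps : R) : R :=
  \int[leb d]_(y in ~` [set y : d.-tuple R | enorm y < eps])
    (tnth y j * f (tsub x y) / enorm y ^+ d.+1).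

(* For square integrable f the truncated integrals converge as eps -> 0+ for
   almost every x; on the exceptional null set lim takes a default value. *)
Definition riesz (j : 'I_d) f : d.-tuple R -> R :=
  fun x => riesz_cst * lim (riesz_trunc j f x eps @[eps --> 0^'+]).

(* R^alpha(f) = R_1^k_1 (R_2^k_2 (... (R_d^k_d f))) for alpha = (k_1,...,k_d) *)
Definition riesz_multi (alpha : {ffun 'I_d -> nat}) f : d.-tuple R -> R :=
  foldr (fun j g => iter (alpha j) (riesz j) g) f (enum 'I_d).

Definition multideg (alpha : {ffun 'I_d -> nat}) : nat :=
  (\sum_(j < d) alpha j)%N.

(* Only the values of C2 at multi-indices of length 2 matter; the last sum is
   over the finite set of these multi-indices. *)
Definition riesz_layer (C0 : R) (C1 : 'I_d -> R)
    (C2 : {ffun 'I_d -> nat} -> R) f : d.-tuple R -> R :=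
  fun x => C0 + \sum_(k < d) C1 k * riesz k f x
    + \sum_(alpha \in [set alpha | multideg alpha = 2%N])
        C2 alpha * riesz_multi alpha f x.

End riesz.

(* Main.v *)
(** The kernel [y_j / |y|^(d+1)] is homogeneous of degree [-d], and Lebesgue
measure on [R^d] is homogeneous of degree [d], so the substitution [y = a z]
turns the integral truncated at [a * eps] for [f(./a)] at [x] into the one
truncated at [eps] for [f] at [x / a]. The germ of right neighbourhoods of [0]
is invariant under [eps |-> a * eps], hence each [R_j] commutes with dilations,
at every point and for every [f]. The substitution only uses that [y |-> a y]
is a bimeasurable bijection, which permutes the simple functions defining the
integral; no measurability of the integrand is involved, so the argument
iterates without knowing that [R_j f] is measurable. *)
Require Import Defs.
From HB Require Import structures.
From mathcomp Require Import all_boot all_order all_algebra.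
From mathcomp Require Import all_classical all_reals all_analysis.
From mathcomp Require Import measurable_realfun ring.

Import Order.TTheory GRing.Theory Num.Theory.
Import numFieldNormedType.Exports.

Local Open Scope classical_set_scope.
Local Open Scope ring_scope.

(** * Change of variables under a bijection that scales the measure *)

Section integral_rescale.
Local Open Scope ereal_scope.
Context (disp : measure_display) (T : measurableType disp) (R : realType).
Variable mu : {measure set T -> \bar R}.

Import HBNNSimple.

Section nnsfun_comp.
Variables (phi : T -> T) (mphi : measurable_fun setT phi).
Variable h : {nnsfun T >-> R}.

Let mhphi : measurable_fun setT (h \o phi).
Proof. exact: measurableT_comp. Qed.

Let hphi_ge0 x : (0 <= (h \o phi) x)%R.
Proof. exact: fun_ge0. Qed.

Let hphi_fin : finite_set (range (h \o phi)).
Proof.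
by apply: sub_finite_set (fimfunP h) => _ [x _ <-]; exact: imageT.
Qed.

Definition nnsfun_comp : {nnsfun T >-> R} :=
  HB.pack (h \o phi) (isMeasurableFun.Build _ _ _ _ _ mhphi)
    (isNonNegFun.Build _ _ _ hphi_ge0) (FiniteImage.Build _ _ _ hphi_fin).

End nnsfun_comp.

(** Each simple function [h] below [f] yields the simple function [c * (h \o phi)] below [g]. Both
    have the same integral, since the level sets of [h] are [c] times as large as their preimages
    under [phi]. *)
Lemma ge0_le_integral_rescale (c : R) (phi : T -> T) (f g : T -> \bar R) :
    (0 < c)%R -> measurable_fun setT phi ->
    (forall A, measurable A -> mu A = c%:E * mu (phi @^-1` A)) ->
    (forall x, 0 <= f x) -> (forall x, g x = c%:E * f (phi x)) ->
  \int[mu]_x f x <= \int[mu]_x g x.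
Proof.
move=> c0 mphi muE f0 gE.
have g0 x : 0 <= g x by rewrite gE mule_ge0// lee_fin ltW.
rewrite !ge0_integralTE//; apply: ge_ereal_sup => _ [h /= hf <-].
apply: ereal_sup_ubound; exists (scale_nnsfun (nnsfun_comp _ mphi h) (ltW c0)).
  by move=> x /=; rewrite gE EFinM lee_pmul2l.
transitivity (sintegral mu (cst c \* nnsfun_comp _ mphi h)%R).
  exact: eq_sintegral.
(* Indexing both sums by all reals, not by ranges, allows a comparison value by value. *)
rewrite sintegralrM !sintegralET ge0_mule_fsumr; last first.
  by move=> r; exact: nnsfun_mulemu_ge0.
apply: eq_fsbigr => r _; rewrite muleCA; congr (_ * _); apply/esym/muE.
by rewrite -[X in measurable X]setTI; exact: measurable_funP.
Qed.

Lemma ge0_integral_rescale (c : R) (phi psi : T -> T) (f g : T -> \bar R) :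
    (0 < c)%R -> measurable_fun setT phi -> measurable_fun setT psi ->
    cancel phi psi -> cancel psi phi ->
    (forall A, measurable A -> mu A = c%:E * mu (phi @^-1` A)) ->
    (forall x, 0 <= f x) -> (forall x, g x = c%:E * f (phi x)) ->
  \int[mu]_x f x = \int[mu]_x g x.
Proof.
move=> c0 mphi mpsi phiK psiK muE f0 gE.
have cVc : c^-1%:E * c%:E = 1 by rewrite -EFinM mulVf// gt_eqF.
apply/eqP; rewrite eq_le; apply/andP; split.
  exact: ge0_le_integral_rescale gE.
(* The reverse inequality exchanges [f] and [g]: the inverse [psi] scales [mu] by [c^-1]. *)
apply: (@ge0_le_integral_rescale c^-1 psi) => //.
- by rewrite invr_gt0.
- move=> A mA; have mpsiA : measurable (psi @^-1` A).
    by rewrite -[X in measurable X]setTI; exact: mpsi.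
  rewrite (muE _ mpsiA) muleA cVc mul1e -comp_preimage (_ : psi \o phi = id) ?preimage_id//.
  by apply/funext => x; exact: phiK.
- by move=> x; rewrite gE mule_ge0// lee_fin ltW.
- by move=> x; rewrite gE psiK muleA cVc mul1e.
Qed.

(** Extension by zero removes the domains; positive and negative parts are then treated separately,
    as multiplication by [c > 0] commutes with both. *)
Lemma integral_rescale (c : R) (phi psi : T -> T) (D E : set T)
    (f g : T -> \bar R) :
    (0 < c)%R -> measurable_fun setT phi -> measurable_fun setT psi ->
    cancel phi psi -> cancel psi phi ->
    (forall A, measurable A -> mu A = c%:E * mu (phi @^-1` A)) ->
    (forall x, E x <-> D (phi x)) -> (forall x, g x = c%:E * f (phi x)) ->
  \int[mu]_(x in D) f x = \int[mu]_(x in E) g x.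
Proof.
move=> c0 mphi mpsi phiK psiK muE DE gE.
rewrite integral_mkcond [RHS]integral_mkcond integralE [RHS]integralE.
have gDE x : (g \_ E) x = c%:E * (f \_ D) (phi x).
  rewrite !patchE gE; case: ifPn => [/set_mem/DE/mem_set->//|].
  move=> xE; rewrite ifF ?mule0//; apply/negbTE; apply: contra xE.
  by move=> /set_mem/DE/mem_set.
congr (_ - _); apply: (@ge0_integral_rescale c phi psi) => // x.
  by rewrite !funeposE gDE maxeMr ?mule0 ?lee_fin// ltW.
by rewrite !funenegE gDE -muleN maxeMr ?mule0 ?lee_fin// ltW.
Qed.

End integral_rescale.

(** * Homogeneity of Lebesgue measure *)

Lemma lebesgue_measure_rescale (R : realType) (a : R) (A : set R) : 0 < a ->
  measurable A ->
  lebesgue_measure A = (a%:E * lebesgue_measure ( *%R a @^-1` A))%E.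
Proof.
move=> a0 mA.
(* By uniqueness, it suffices to compare the two measures on intervals []u, v]]. *)
have := @lebesgue_measure_unique R (mscale (NngNum (ltW a0))
  (pushforward lebesgue_measure
     ( *%R a : measurableTypeR R -> measurableTypeR R))).
apply => // _ [[u v] _ <-].
pose I : set R := `]a^-1 * u, a^-1 * v]%classic.
transitivity (a%:E * lebesgue_measure I)%E.
  rewrite /I !lebesgue_measure_itv/= !lte_fin ltr_pM2l ?invr_gt0//.
  case: ifPn => _; last by rewrite mule0.
  by rewrite -!EFinB -EFinM -mulrBr mulVKf// gt_eqF.
congr (_ * lebesgue_measure _)%E; apply/seteqP.
by split => z/=; rewrite /I/= !in_itv/= ler_pdivlMl// ltr_pdivrMl.
Qed.

Section tscale.
Context {R : realType} {d : nat}.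

Lemma tscaleK (a : R) : a != 0 -> cancel (@tscale R d a) (tscale a^-1).
Proof.
by move=> a0 x; apply: eq_from_tnth => i; rewrite !tnth_mktuple mulKf.
Qed.

Lemma measurable_tscale (a : R) : measurable_fun setT (@tscale R d a).
Proof.
apply/measurable_fun_tnthP => i.
rewrite (_ : _ \o _ = (fun x => a * tnth x i)); last first.
  by apply/funext => x /=; rewrite tnth_mktuple.
apply: measurableT_comp; [exact: mulrl_measurable | exact: measurable_tnth].
Qed.

Lemma enorm_tscale (a : R) (x : d.-tuple R) : 0 <= a ->
  enorm (tscale a x) = a * enorm x.
Proof.
move=> a0; rewrite /enorm -{2}(ger0_norm a0) -sqrtr_sqr -sqrtrM ?sqr_ge0// mulr_sumr.
by congr Num.sqrt; apply: eq_bigr => i _; rewrite tnth_mktuple exprMn.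
Qed.

End tscale.

Lemma tscale_tcons (R : realType) (n : nat) (a : R) p :
  tscale a (@tcons R n p) = tcons (a * p.1, tscale a p.2).
Proof.
apply: eq_from_tnth => i; rewrite tnth_mktuple.
case: (unliftP ord0 i) => [j ->|->]; last by rewrite !tnth0.
by rewrite !tnthS tnth_mktuple.
Qed.

(** Fubini by induction on [n]: the sections contribute [a ^+ n], and rescaling the integral over
    the first coordinate contributes one more [a]. *)
Lemma leb_rescale (R : realType) (n : nat) (a : R) : 0 < a ->
  forall A, measurable A ->
  leb n A = ((a ^+ n)%:E * leb n (tscale a @^-1` A))%E.
Proof.
move=> a0; elim: n => [|n IH] A mA.
  rewrite expr0 mul1e; congr (_ _); apply/seteqP.
  by split => x /=; rewrite (tuple0 (tscale a x)) (tuple0 x).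
rewrite /= /leb_step /pushforward /= /product_measure1.
set B := _ @^-1` A.
have mB : measurable B by rewrite -[B]setTI; exact: measurable_tcons.
have xE s : xsection (tcons (n:=n) @^-1` (tscale a @^-1` A)) s
    = tscale a @^-1` (xsection B (a * s)).
  by apply/seteqP; split => t /=; rewrite /xsection /= !in_setE /= tscale_tcons.
have mC : measurable (tcons (n:=n) @^-1` (tscale a @^-1` A)).
  rewrite -[X in measurable X]setTI; apply: measurable_tcons => //.
  by rewrite -[X in measurable X]setTI; exact: measurable_tscale.
rewrite -ge0_integralZl//; last 2 first.
- exact: measurable_fun_xsection.
- by rewrite lee_fin exprn_ge0// ltW.
apply: (@ge0_integral_rescale _ (measurableTypeR R) R lebesgue_measure a
  ( *%R a) ( *%R a^-1)) => //.
- by apply: mulKf; rewrite gt_eqF.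
- by apply: mulVKf; rewrite gt_eqF.
- by move=> ? ?; exact: lebesgue_measure_rescale.
- move=> s /=; rewrite xE exprS EFinM -muleA [in RHS](IH (xsection B (a * s)))//.
  exact: measurable_xsection.
Qed.

(** * Dilation of the truncated integrals and of their limits *)

Lemma at_right0_scale (R : realType) (a : R) (P : set R) : 0 < a ->
  (0:R)^'+ P -> (0:R)^'+ (fun e => P (a * e)).
Proof.
move=> a0 [r /= r0 rP]; exists (r / a) => /=; first by rewrite divr_gt0.
move=> e /= er e0; apply: rP; last by rewrite mulr_gt0.
by move: er; rewrite /= !sub0r !normrN ltr_pdivlMr// mulrC normrM (gtr0_norm a0).
Qed.

Lemma lim_at_right0_scale (R : realType) (a : R) (F : R -> R) : 0 < a ->
  lim (F (a * e) @[e --> (0:R)^'+]) = lim (F e @[e --> (0:R)^'+]).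
Proof.
(* The two image filters are equal, so the values of [lim] agree even without convergence, where
   [lim] is a default value. *)
move=> a0; congr (lim _); apply/seteqP; split => P /=; last first.
  exact: at_right0_scale.
have aV0 : 0 < a^-1 by rewrite invr_gt0.
move=> /(at_right0_scale _ _ _ aV0); rewrite /nbhs /= /fmap /=.
by apply: filterS => e /=; rewrite mulVKf// gt_eqF.
Qed.

Lemma riesz_trunc_dilate (R : realType) (d : nat) (j : 'I_d)
    (f : d.-tuple R -> R) (a : R) (x : d.-tuple R) (eps : R) : 0 < a ->
  riesz_trunc j (dilate a f) x (a * eps) = riesz_trunc j f (tscale a^-1 x) eps.
Proof.
move=> a0; have an0 : a != 0 by rewrite gt_eqF.
rewrite /riesz_trunc /Rintegral; congr fine.
(* The powers of [a] cancel: [d] from the measure, one from the numerator [tnth y j], and [d.+1]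
   from the denominator. *)
apply: (@integral_rescale _ _ _ _ (a ^+ d) (tscale a) (tscale a^-1)).
- by rewrite exprn_gt0.
- exact: measurable_tscale.
- exact: measurable_tscale.
- exact: tscaleK.
- by rewrite -{2}(invrK a); apply: tscaleK; rewrite invr_eq0.
- by move=> A mA; exact: leb_rescale.
- by move=> y /=; rewrite enorm_tscale ?ltW// ltr_pM2l.
- move=> y; rewrite -EFinM; congr EFin.
  have -> : tsub (tscale a^-1 x) y = tscale a^-1 (tsub x (tscale a y)).
    by apply: eq_from_tnth => i; rewrite !tnth_mktuple mulrBr mulKf.
  rewrite enorm_tscale ?ltW// tnth_mktuple exprMn invfM (exprS a) /dilate.
  (* abstracting the inverse spares [field] the condition [enorm y != 0],
     which fails at the origin *)
  move: (f _) (enorm y ^- d.+1) => u v.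
  by field; rewrite an0 expf_neq0.
Qed.

Lemma riesz_dilate (R : realType) (d : nat) (j : 'I_d) (a : R)
    (f : d.-tuple R -> R) : 0 < a ->
  riesz j (dilate a f) = dilate a (riesz j f).
Proof.
move=> a0; apply/funext => x; rewrite /riesz [in RHS]/dilate; congr (_ * _).
(* The left-hand radius becomes [a * eps], matching the radius [eps] for [f] at [tscale a^-1 x]. *)
rewrite -(lim_at_right0_scale _ _ (riesz_trunc j (dilate a f) x) a0).
by under eq_fun do rewrite riesz_trunc_dilate//.
Qed.

Lemma riesz_multi_dilate (R : realType) (d : nat) (alpha : {ffun 'I_d -> nat})
    (a : R) (f : d.-tuple R -> R) : 0 < a ->
  riesz_multi alpha (dilate a f) = dilate a (riesz_multi alpha f).
Proof.
move=> a0; rewrite /riesz_multi.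
elim: (enum 'I_d) => //= j s ->.
by elim: (alpha j) => //= k ->; exact: riesz_dilate.
Qed.

Theorem mainTheorem1 (R : realType) (d : nat) (d_ge1 : (1 <= d)%N)
    (C0 : R) (C1 : 'I_d -> R) (C2 : {ffun 'I_d -> nat} -> R)
    (f : d.-tuple R -> R) (f_L2 : f \in Lfun (leb d) 2%:E)
    (a : R) (a_gt0 : 0 < a) :
  {ae leb d, forall x : d.-tuple R,
    riesz_layer C0 C1 C2 (dilate a f) x
    = dilate a (riesz_layer C0 C1 C2 f) x}.
Proof.
apply: aeW => x; rewrite /riesz_layer [in RHS]/dilate; congr (_ + _ + _).
  by apply: eq_bigr => k _; rewrite riesz_dilate.
by apply: eq_fsbigr => alpha _; rewrite riesz_multi_dilate.
Qed.
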